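(* Let $G$ be the infinite grid graph with vertex set $\mathbb{Z}^2$ and let $f$ be a conservative flow configuration on $G$ with finite support (only finitely many edges have nonzero flow). Then every run of the flow-firing process started from $f$ terminates after finitely many steps, i.e. there is no infinite sequence of firings starting from $f$.
   Context: Each edge of the grid graph $G$ (vertices $\mathbb{Z}^2$, edges between points at Euclidean distance $1$) is oriented from South to North or from West to East. A flow configuration is a function $f$ assigning an integer $f_e$ to each edge $e$; $f_e>0$ means $f_e$ units of flow along the orientation of $e$, $f_e<0$ means $|f_e|$ units against it. It is conservative if for every vertex $v$, $\mathrm{inflow}(v)-\mathrm{outflow}(v)=\sum_{e \text{ oriented into } v} f_e-\sum_{e \text{ oriented out of } v} f_e=0$. The faces of $G$ are the unit squares; each edge lies in exactly two faces. Rerouting one unit of flow on an edge $e$ across a face $\sigma\ni e$ means replacing one unit of flow along $e$ (in the direction in which flow currently runs on $e$) by one unit of flow along the path formed by the other three edges of $\sigma$ (same endpoints), adding these to existing values (opposite flows cancel). Flow-firing process: at each step choose an edge $e$ with $|f_e|\ge2$ and fire it, i.e. reroute one unit of its flow across each of the two faces containing $e$. The process terminates when no edge has $|f_e|\ge 2$. *)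

(* Defs.v *)
From mathcomp Require Import all_boot all_order all_algebra zify.

Set Implicit Arguments.
Unset Strict Implicit.
Unset Printing Implicit Defensive.

Import GRing.Theory Num.Theory.
Local Open Scope ring_scope.

Definition vertex : Type := (int * int)%type.

Definition east (v : vertex) : vertex := (v.1 + 1, v.2).
Definition north (v : vertex) : vertex := (v.1, v.2 + 1).
Definition west (v : vertex) : vertex := (v.1 - 1, v.2).
Definition south (v : vertex) : vertex := (v.1, v.2 - 1).

(* [(v, false)] is the edge oriented from [v] to [east v], and [(v, true)] the
   edge oriented from [v] to [north v]. *)
Definition edge : Type := (vertex * bool)%type.

Definition hedge (v : vertex) : edge := (v, false).
Definition vedge (v : vertex) : edge := (v, true).

Definition tail (e : edge) : vertex := e.1.
Definition head (e : edge) : vertex := if e.2 then north e.1 else east e.1.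

Definition flow : Type := edge -> int.

Definition edges_into (v : vertex) : seq edge :=
  [:: hedge (west v); vedge (south v)].
Definition edges_out_of (v : vertex) : seq edge := [:: hedge v; vedge v].

Lemma mem_edges_into (v : vertex) (e : edge) :
  (e \in edges_into v) = (head e == v).
Proof.
case: e v => [[x y] []] [a b]; rewrite !inE /head !xpair_eqE /=; lia.
Qed.

Lemma mem_edges_out_of (v : vertex) (e : edge) :
  (e \in edges_out_of v) = (tail e == v).
Proof.
by case: e => u []; rewrite !inE /tail !xpair_eqE /= ?andbT ?andbF ?orbF.
Qed.

Definition inflow (f : flow) (v : vertex) : int := \sum_(e <- edges_into v) f e.
Definition outflow (f : flow) (v : vertex) : int :=
  \sum_(e <- edges_out_of v) f e.

Definition conservative (f : flow) : Prop :=
  forall v : vertex, inflow f v - outflow f v = 0.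

Definition finite_support (f : flow) : Prop :=
  exists s : seq edge, forall e : edge, f e != 0 -> e \in s.

(* An edge with the direction in which it is traversed: [1] along its
   orientation, [-1] against it. *)
Definition dart : Type := (edge * int)%type.

(* One unit of flow sent along each of the darts of [p]. *)
Definition unit_flow (p : seq dart) : flow :=
  fun e => \sum_(d <- p | d.1 == e) d.2.

(* A face is the unit square named by its south-west corner. *)
Definition face : Type := vertex.

(* The counterclockwise cycle around a face. *)
Definition boundary (s : face) : seq dart :=
  [:: (hedge s, 1); (vedge (east s), 1); (hedge (north s), -1); (vedge s, -1)].

Definition face_edges (s : face) : seq edge := [seq d.1 | d <- boundary s].

Definition faces_of (e : edge) : face * face :=
  (e.1, if e.2 then west e.1 else south e.1).

Lemma mem_face_edges (s : face) (e : edge) :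
  (e \in face_edges s) = (s == (faces_of e).1) || (s == (faces_of e).2).
Proof.
case: e s => [[x y] []] [a b]; rewrite !inE !xpair_eqE /=; lia.
Qed.

(* The three other edges of [s], directed so as to lead from [tail e] to
   [head e]: clockwise if the counterclockwise cycle follows [e] along its
   orientation, counterclockwise otherwise. *)
Definition detour (s : face) (e : edge) : seq dart :=
  [seq (d.1, - unit_flow (boundary s) e * d.2) | d <- boundary s & d.1 != e].

Lemma detour_endpoints (s : face) (e : edge) (v : vertex) :
  e \in face_edges s ->
  let g := unit_flow (detour s e) in
  inflow g v - outflow g v = (v == head e)%:R - (v == tail e)%:R.
Proof.
rewrite /inflow /outflow /detour /unit_flow; case: s v => x y [a b].
rewrite /face_edges /= !inE => /or4P[] /eqP->.
all: rewrite /edges_into /edges_out_of /boundary /head /tail !big_cons !big_nil /=.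
all: rewrite !xpair_eqE /= !eqxx /= ?andbT ?andbF.
all: have E1 (z : int) : (z + 1 == z) = false by lia.
all: have E2 (z : int) : (z == z + 1) = false by lia.
all: rewrite ?E1 ?E2 ?andbF /= !big_cons !big_nil /= !xpair_eqE /= ?andbT ?andbF.
all: repeat case: ifP => ?; try lia.
Qed.

(* [sgz (f e)] is the direction in which flow currently runs on [e]. *)
Definition reroute (s : face) (e : edge) (f : flow) : flow :=
  fun e' => f e' - sgz (f e) * unit_flow [:: (e, 1)] e'
                 + sgz (f e) * unit_flow (detour s e) e'.

(* When [2 <= `|f e|], the first rerouting leaves at least one unit on [e] in the
   same direction, so the order of the two faces is irrelevant. *)
Definition fire (e : edge) (f : flow) : flow :=
  reroute (faces_of e).2 e (reroute (faces_of e).1 e f).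

Definition firing_step (f g : flow) : Prop :=
  exists e : edge, 2 <= `|f e| /\ g =1 fire e f.

(* Main.v *)
Require Import Defs.
From mathcomp Require Import all_boot all_order all_algebra.
From mathcomp Require Import zify ring.

(** A finitely supported conservative flow is the discrete curl of a finitely
    supported integer height function [h] on the faces: the flow on an edge is
    the difference of the heights of its two faces.  Firing an edge lowers the
    higher of the two faces by one and raises the lower one by one; since the
    heights differ by at least 2, the sum of the squared heights decreases. *)

Set Implicit Arguments.
Unset Strict Implicit.
Unset Printing Implicit Defensive.

Import Order.TTheory GRing.Theory Num.Theory.
Local Open Scope ring_scope.

(** * Firings as moves of height functions *)

Definition edge_sign (e : edge) : int := if e.2 then -1 else 1.

(** [edge_sign e] is the coefficient of [e] in the counterclockwise boundary of its first face, so
    this is the sum of all face boundaries weighted by [h]. *)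
Definition curl (h : face -> int) : flow :=
  fun e => edge_sign e * (h (faces_of e).1 - h (faces_of e).2).

Lemma edge_sign_sqr (e : edge) : edge_sign e * edge_sign e = 1.
Proof. by rewrite /edge_sign; case: e.2. Qed.

Lemma faces_of_neq (e : edge) : (faces_of e).1 != (faces_of e).2.
Proof. by case: e => [[x y] []]; rewrite xpair_eqE /=; lia. Qed.

Lemma unit_flow_boundary (s : face) (e : edge) :
  unit_flow (boundary s) e = curl (fun t => (t == s)%:R) e.
Proof.
case: e s => [[x y] []] [a b];
  rewrite /unit_flow /curl /edge_sign !big_cons big_nil /=;
  rewrite /hedge /vedge /east /west /north /south !xpair_eqE /= ?andbT ?andbF;
  repeat case: ifP => ?; lia.
Qed.

Lemma unit_flow_boundary_face1 (e : edge) :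
  unit_flow (boundary (faces_of e).1) e = edge_sign e.
Proof.
rewrite unit_flow_boundary /curl eqxx eq_sym (negPf (faces_of_neq e)).
by rewrite subr0 mulr1.
Qed.

Lemma unit_flow_boundary_face2 (e : edge) :
  unit_flow (boundary (faces_of e).2) e = - edge_sign e.
Proof.
by rewrite unit_flow_boundary /curl eqxx (negPf (faces_of_neq e)) sub0r mulrN1.
Qed.

Lemma unit_flow_detour (s : face) (e e' : edge) :
  unit_flow (detour s e) e' =
    if e' == e then 0
    else - (unit_flow (boundary s) e * unit_flow (boundary s) e').
Proof.
rewrite {1}/unit_flow /detour big_map big_filter_cond /=.
case: eqP => [-> | /eqP ne].
  by rewrite big_pred0 // => d; case: (d.1 == e).
rewrite {3}/unit_flow -mulNr mulr_sumr; apply: eq_bigl => d.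
by case: (d.1 =P e') => [->|_]; rewrite ?ne ?andbF.
Qed.

(** The removed unit on [e] and the added detour together form one whole boundary cycle of [s]. The
    hypothesis, that the coefficient of [e] in that cycle is a sign, encodes that [e] lies on
    [s]. *)
Lemma reroute_boundary (s : face) (e e' : edge) (f : flow) :
  unit_flow (boundary s) e * unit_flow (boundary s) e = 1 ->
  reroute s e f e' =
    f e' - sgz (f e) * unit_flow (boundary s) e * unit_flow (boundary s) e'.
Proof.
move=> sq1; rewrite /reroute unit_flow_detour.
rewrite {1}/unit_flow big_cons big_nil /= eq_sym.
case: eqP => [-> | _]; last by ring.
by rewrite -mulrA sq1; ring.
Qed.

Definition level_faces (a : face) (b : face) (h : face -> int) : face -> int :=
  fun t => h t - (t == a)%:R + (t == b)%:R.

Lemma fire_curl (e : edge) (f : flow) (h : face -> int) :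
  2 <= `|f e| -> f =1 curl h ->
  exists a b : face, 2 <= h a - h b /\ fire e f =1 curl (level_faces a b h).
Proof.
move=> fe2 fh.
(* The sign of the height of the first face minus that of the second: it tells which of the two is
   the higher. *)
set c := sgz (f e) * edge_sign e.
have fireE e' : fire e f e' = curl (fun t => h t - c * (t == (faces_of e).1)%:R
                                 + c * (t == (faces_of e).2)%:R) e'.
  have sq1 : unit_flow (boundary (faces_of e).1) e
             * unit_flow (boundary (faces_of e).1) e = 1.
    by rewrite unit_flow_boundary_face1 edge_sign_sqr.
  have sq2 : unit_flow (boundary (faces_of e).2) e
             * unit_flow (boundary (faces_of e).2) e = 1.
    by rewrite unit_flow_boundary_face2 mulrNN edge_sign_sqr.
  have sg1 : sgz (reroute (faces_of e).1 e f e) = sgz (f e).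
    by rewrite reroute_boundary // -mulrA sq1 mulr1; lia.
  rewrite /fire reroute_boundary // sg1 reroute_boundary //.
  rewrite unit_flow_boundary_face1 unit_flow_boundary_face2.
  rewrite !unit_flow_boundary fh /curl /c; ring.
have fe : f e = edge_sign e * (h (faces_of e).1 - h (faces_of e).2) by exact: fh.
have [c1 | cN1] : c = 1 \/ c = -1.
- by rewrite /c /edge_sign; case: e.2; lia.
- exists (faces_of e).1, (faces_of e).2; split.
    by move: c1 fe; rewrite /c /edge_sign; case: e.2; lia.
  by move=> e'; rewrite fireE c1 /curl /level_faces; ring.
exists (faces_of e).2, (faces_of e).1; split.
  by move: cN1 fe; rewrite /c /edge_sign; case: e.2; lia.
by move=> e'; rewrite fireE cN1 /curl /level_faces; ring.
Qed.

(** * Descent of the energy *)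

Definition energy (s : seq face) (h : face -> int) : int :=
  \sum_(t <- s) h t ^+ 2.

Lemma energy_ge0 (s : seq face) (h : face -> int) : 0 <= energy s h.
Proof. by apply: sumr_ge0 => t _; apply: sqr_ge0. Qed.

Lemma energy_supportE (s s' : seq face) (h : face -> int) :
  uniq s -> uniq s' -> {subset s <= s'} ->
  (forall t, h t != 0 -> t \in s) -> energy s' h = energy s h.
Proof.
move=> us us' ss' hs; rewrite /energy (bigID (mem s)) /=.
rewrite [X in _ + X]big1 ?addr0 => [|t]; last first.
  by move=> /negP ts; case: (eqVneq (h t) 0) => [-> | /hs] //; rewrite expr0n.
rewrite -big_filter; apply: perm_big; apply: uniq_perm; rewrite ?filter_uniq //.
by move=> t; rewrite mem_filter; case: (boolP (t \in s)) => // /ss' ->.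
Qed.

(** Only the terms at [a] and [b] change, and the sum drops by exactly [2 * (h a - h b - 1)], which
    is at least 2. *)
Lemma energy_level_faces (s : seq face) (a b : face) (h : face -> int) :
  uniq s -> a \in s -> b \in s -> 2 <= h a - h b ->
  energy s (level_faces a b h) < energy s h.
Proof.
move=> us sa sb hab.
have ab : a != b by apply/eqP => abE; move: hab; rewrite abE subrr.
have sb' : b \in rem a s by rewrite mem_rem_uniq // inE eq_sym ab.
have us' : uniq (rem a s) by rewrite rem_uniq.
rewrite /energy !(perm_big _ (perm_to_rem sa)) !big_cons /=.
rewrite !(perm_big _ (perm_to_rem sb')) !big_cons /=.
rewrite [X in _ + (_ + X) < _](_ : _ = \sum_(j <- rem b (rem a s)) h j ^+ 2).
  rewrite /level_faces !eqxx (negPf ab) eq_sym (negPf ab) /=.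
  rewrite !addrA ltrD2r -subr_gt0.
  rewrite [X in 0 < X](_ : _ = 2 * (h a - h b - 1)); last by ring.
  lia.
rewrite big_seq [RHS]big_seq; apply: eq_bigr => t.
rewrite !mem_rem_uniq // !inE => /andP[/negPf tb].
rewrite mem_rem_uniq // inE => /andP[/negPf ta _].
by rewrite /level_faces ta tb subr0 addr0.
Qed.

(** Induction on a strict bound for the energy. The list [s] varies along the induction because a
    firing can make the height nonzero at new faces; by [energy_supportE], enlarging the list leaves
    the energy unchanged. *)
Lemma curl_terminates (n : nat) (s : seq face) (h : face -> int)
    (run : nat -> flow) :
  uniq s -> (forall t, h t != 0 -> t \in s) -> energy s h < n%:Z ->
  run 0%N =1 curl h -> ~ forall k, firing_step (run k) (run k.+1).
Proof.
elim: n s h run => [|n IHn] s h run us hs en run0 steps.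
  by have := energy_ge0 s h; rewrite leNgt en.
have [e [fe2 run1]] := steps 0%N.
have [a [b [hab fireE]]] := fire_curl fe2 run0.
pose s' := undup (a :: b :: s).
have ss' : {subset s <= s'} by move=> t ts; rewrite mem_undup !inE ts !orbT.
have sa : a \in s' by rewrite mem_undup !inE eqxx.
have sb : b \in s' by rewrite mem_undup !inE eqxx orbT.
have us' : uniq s' by rewrite undup_uniq.
apply: (IHn s' (level_faces a b h) (fun k => run k.+1)) => //.
- move=> t; rewrite mem_undup !inE /level_faces.
  case: (eqVneq t a) => //= _; case: (eqVneq t b) => //= _.
  by rewrite subr0 addr0; apply: hs.
- have := energy_level_faces us' sa sb hab.
  by rewrite (energy_supportE us us' ss' hs); lia.
by move=> e'; rewrite run1 fireE.
Qed.

(** * Construction of a finitely supported height *)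

Definition vanishes_beyond (n : nat) (f : flow) : Prop :=
  forall x y b, (n < `|x|)%N || (n < `|y|)%N -> f ((x, y), b) = 0.

Lemma finite_support_bound (f : flow) :
  finite_support f ->
  exists n : nat, vanishes_beyond n f.
Proof.
case=> s fs; exists (\max_(e <- s) maxn `|e.1.1| `|e.1.2|)%N => x y b far.
apply/eqP/negPn/negP => /fs es.
have := @leq_bigmax_seq _ s predT (fun e : edge => maxn `|e.1.1| `|e.1.2|)%N
  _ es isT.
rewrite /= geq_max => /andP[].
by case/orP: far; rewrite ltnNge => /negP.
Qed.

Lemma conservative_xy (f : flow) (x y : int) :
  conservative f ->
  f (hedge (x - 1, y)) + f (vedge (x, y - 1))
    = f (hedge (x, y)) + f (vedge (x, y)).
Proof.
move=> /(_ (x, y)) /eqP; rewrite subr_eq0 => /eqP.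
by rewrite /inflow /outflow !big_cons !big_nil !addr0.
Qed.

(* The number of horizontal edges of a column at heights [-n], ..., [y]. *)
Definition column_size (n : nat) (y : int) : nat :=
  `|Num.max (0 : int) (y + n%:Z + 1)%R|%N.

Definition column_flux (n : nat) (f : flow) (x : int) (k : nat) : int :=
  \sum_(i < k) f (hedge (x, i%:Z - n%:Z)).

(** The eastward flow across the ray going down from the centre of the face, a discrete stream
    function. The sum may start at [- n] when [f] vanishes below. *)
Definition height (n : nat) (f : flow) : face -> int :=
  fun t => column_flux n f t.1 (column_size n t.2).

(** Conservation is summed over the [k] vertices of the column of abscissa [x] from [- n] upwards.
    The vertical edges telescope; the lowest one is beyond the support, so only the top one
    remains. *)
Lemma column_flux_sub (n : nat) (f : flow) (x : int) (k : nat) :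
  conservative f -> vanishes_beyond n f ->
  column_flux n f (x - 1) k - column_flux n f x k
    = f (vedge (x, k%:Z - 1 - n%:Z)).
Proof.
move=> f_conservative f_far.
elim: k => [|k IHk].
  by rewrite /column_flux !big_ord0 f_far //; lia.
have := conservative_xy x (k%:Z - n%:Z) f_conservative.
rewrite (_ : k%:Z - n%:Z - 1 = k%:Z - 1 - n%:Z); last by lia.
rewrite (_ : k.+1%:Z - 1 - n%:Z = k%:Z - n%:Z); last by lia.
rewrite -IHk /column_flux !big_ord_recr /= => balance.
by rewrite -[RHS](addKr (f (hedge (x, k%:Z - n%:Z)))) -balance; ring.
Qed.

Lemma curl_height (n : nat) (f : flow) :
  conservative f -> vanishes_beyond n f -> f =1 curl (height n f).
Proof.
move=> f_conservative f_far.
case=> [[x y] []]; rewrite /curl /edge_sign /height /=.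
  rewrite mulN1r opprB column_flux_sub //.
  (* Below [- n] the column size is truncated to 0 and no longer determines [y], but both edges
     being compared then carry no flow. *)
  have [y_lt | y_ge] := ltP y (- n%:Z).
    by rewrite !f_far /column_size //; lia.
  by congr (f ((_, _), _)); rewrite /column_size; lia.
rewrite mul1r.
have [y_lt | y_ge] := ltP y (- n%:Z).
  rewrite (_ : column_size n y = 0%N); last by rewrite /column_size; lia.
  rewrite (_ : column_size n (y - 1) = 0%N); last by rewrite /column_size; lia.
  by rewrite subrr f_far //; lia.
rewrite (_ : column_size n y = (column_size n (y - 1)).+1); last first.
  by rewrite /column_size; lia.
rewrite /column_flux big_ord_recr /= [X in X - _]addrC addrK.
by congr (f ((_, _), _)); rewrite /column_size; lia.
Qed.

Lemma column_flux_far (n : nat) (f : flow) (x : int) (k : nat) :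
  vanishes_beyond n f -> (n < `|x|)%N -> column_flux n f x k = 0.
Proof.
move=> f_far xn; rewrite /column_flux big1 // => i _.
by rewrite f_far ?xn.
Qed.

(* No flow crosses the vertical edges above height [n], so a full column has the
   same flux as its neighbour, hence as a column beyond the support. *)
Lemma column_flux_full (n : nat) (f : flow) (x : int) (k : nat) :
  conservative f -> vanishes_beyond n f ->
  (n.*2.+1 < k)%N -> column_flux n f x k = 0.
Proof.
move=> f_conservative f_far kn.
have shift m : column_flux n f x k = column_flux n f (x + m%:Z) k.
  elim: m => [|m ->]; first by rewrite addr0.
  apply/eqP; rewrite -subr_eq0.
  rewrite [X in column_flux _ _ X _](_ : _ = x + m.+1%:Z - 1); last by lia.
  by rewrite column_flux_sub // f_far //; lia.
(* Going east by this amount passes the abscissa [n] whatever the sign of [x]. *)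
by rewrite (shift (`|x| + n).+1) column_flux_far //; lia.
Qed.

(** Far to the east or west a column carries no flow; far below it is empty, and far above it is
    full, with total flux zero. *)
Lemma height_support (n : nat) (f : flow) :
  conservative f -> vanishes_beyond n f ->
  exists2 s : seq face, uniq s & forall t, height n f t != 0 -> t \in s.
Proof.
move=> f_conservative f_far.
pose range := [seq i%:Z - n.+1%:Z | i <- iota 0 (n.*2 + 3)].
have mem_range z : (`|z| <= n.+1)%N -> z \in range.
  move=> zn; apply/mapP; exists `|(z + n.+1%:Z)%R|%N; last by lia.
  by rewrite mem_iota; lia.
exists (undup [seq (x, y) | x <- range, y <- range]); first exact: undup_uniq.
case=> x y hxy; rewrite mem_undup.
have xn : (`|x| <= n)%N.
  rewrite leqNgt; apply: contra hxy => xn.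
  by rewrite /height column_flux_far.
have yn : (`|y| <= n.+1)%N.
  rewrite leqNgt; apply: contra hxy => yn; rewrite /height /=.
  have [y_lt0 | y_ge0] := ltP y 0.
    rewrite (_ : column_size n y = 0%N); last by rewrite /column_size; lia.
    by rewrite /column_flux big_ord0.
  by rewrite column_flux_full // /column_size; lia.
by apply: allpairs_f; apply: mem_range => //; apply: leqW.
Qed.

Theorem theorem5p2 (f : flow) (f_conservative : conservative f)
    (f_finite : finite_support f) :
  ~ exists run : nat -> flow,
      run 0%N =1 f /\ forall n : nat, firing_step (run n) (run n.+1).
Proof.
case=> run [run0 steps].
have [n f_far] := finite_support_bound f_finite.
have [s us hs] := height_support f_conservative f_far.
apply: (@curl_terminates `|energy s (height n f)|.+1 s (height n f) run) => //.
  by have := energy_ge0 s (height n f); lia.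
by move=> e; rewrite run0; apply: curl_height.
Qed.
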